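(* Let $\mathcal{A}$ be a nonempty finite set and let $(G_a)_{a \in \mathcal{A}}$ be a family of probabilistic graphs. Then $$\overline{H}\left(\bigsqcup_{a \in \mathcal{A}}^{\mathrm{Unif}(\mathcal{A})} G_a\right) = \frac{1}{|\mathcal{A}|}\,\overline{H}\left(\bigwedge_{a \in \mathcal{A}} G_a\right),$$ where $\mathrm{Unif}(\mathcal{A})$ is the uniform distribution on $\mathcal{A}$.
   Context: $\Delta(\mathcal{X})$ denotes the set of probability distributions on a finite set $\mathcal{X}$. A probabilistic graph is a tuple $G=(\mathcal{V},\mathcal{E},P_V)$ where $(\mathcal{V},\mathcal{E})$ is a finite simple undirected graph and $P_V\in\Delta(\mathcal{V})$. AND product: $G_1\wedge G_2$ has vertex set $\mathcal{V}_1\times\mathcal{V}_2$, distribution $P_{V_1}P_{V_2}$ (product distribution), and two distinct vertices $(v_1,v_2),(v_1',v_2')$ are adjacent iff ($v_1=v_1'$ or $v_1v_1'\in\mathcal{E}_1$) and ($v_2=v_2'$ or $v_2v_2'\in\mathcal{E}_2$). $G^{\wedge n}$ is the $n$-fold AND product $G\wedge\dots\wedge G$. Disjoint union: for $P_A\in\Delta(\mathcal{A})$ and $G_a=(\mathcal{V}_a,\mathcal{E}_a,P_{V_a})$, $\bigsqcup_{a\in\mathcal{A}}^{P_A}G_a$ has vertex set the disjoint union of the $\mathcal{V}_a$; two vertices are adjacent iff they lie in the same $\mathcal{V}_a$ and are adjacent in $G_a$; its distribution is $\sum_{a}P_A(a)P_{V_a}$. A coloring of $G$ is a map $c$ on $\mathcal{V}$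 such that adjacent vertices receive different values. The chromatic entropy is $H_\chi(G)=\inf\{H(c(V)) : c \text{ a coloring of } G\}$, where $V\sim P_V$ and $H$ is Shannon entropy (logarithms in base 2). The complementary graph entropy is $\overline{H}(G)=\lim_{n\to\infty}\frac1n H_\chi(G^{\wedge n})$ (the limit exists). *)

(* Defs.v *)
From HB Require Import structures.
From mathcomp Require Import all_boot all_order all_algebra.
From mathcomp Require Import all_classical all_reals all_analysis.

Set Implicit Arguments.
Unset Strict Implicit.
Unset Printing Implicit Defensive.

Import Order.TTheory GRing.Theory Num.Theory.
Import numFieldNormedType.Exports.
Local Open Scope ring_scope.
Local Open Scope classical_set_scope.

Record dist (R : realType) (T : finType) := Dist {
  pmf :> T -> R;
  dist_ge0 : forall x, 0 <= pmf x;
  dist_sum1 : \sum_x pmf x = 1 }.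

Section Dist.
Variable R : realType.

Section Uniform.
Variables (T : finType) (T_gt0 : (0 < #|T|)%N).

Lemma unif_ge0 (x : T) : 0 <= (#|T|%:R^-1 : R).
Proof. by rewrite invr_ge0. Qed.

Lemma unif_sum1 : \sum_(x : T) (#|T|%:R^-1 : R) = 1.
Proof.
by rewrite sumr_const -[LHS]mulr_natl mulfV // pnatr_eq0 -lt0n.
Qed.

Definition unif : dist R T := Dist unif_ge0 unif_sum1.
End Uniform.

(* The law of [f X] when [X] has law [P]. *)
Section Pushforward.
Variables (T C : finType) (P : dist R T) (f : T -> C).

Lemma dmap_ge0 (c : C) : 0 <= \sum_(x | f x == c) P x.
Proof. by apply: sumr_ge0 => x _; exact: dist_ge0. Qed.

Lemma dmap_sum1 : \sum_c \sum_(x | f x == c) P x = 1.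
Proof. by rewrite -(dist_sum1 P) (partition_big f xpredT). Qed.

Definition dmap : dist R C := Dist dmap_ge0 dmap_sum1.
End Pushforward.

Section BinaryProduct.
Variables (T1 T2 : finType) (P1 : dist R T1) (P2 : dist R T2).

Lemma dprod2_ge0 (x : T1 * T2) : 0 <= P1 x.1 * P2 x.2.
Proof. by apply: mulr_ge0; exact: dist_ge0. Qed.

Lemma dprod2_sum1 : \sum_(x : T1 * T2) P1 x.1 * P2 x.2 = 1.
Proof.
rewrite -(pair_bigA _ (fun x y => P1 x * P2 y)) /= -(dist_sum1 P1).
by apply: eq_bigr => x _; rewrite -mulr_sumr dist_sum1 mulr1.
Qed.

Definition dprod2 : dist R (T1 * T2)%type := Dist dprod2_ge0 dprod2_sum1.
End BinaryProduct.

Section IndexedProduct.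
Variables (A : finType) (T : A -> finType) (P : forall a, dist R (T a)).

Lemma dprod_ge0 (x : {dffun forall a, T a}) : 0 <= \prod_a P a (x a).
Proof. by apply: prodr_ge0 => a _; exact: dist_ge0. Qed.

Lemma dprod_sum1 : \sum_(x : {dffun forall a, T a}) \prod_a P a (x a) = 1.
Proof.
rewrite (reindex (@dffun_of_fprod _ T)); last first.
  exact/onW_bij/dffun_of_fprod_bij.
pose p a := [ffun x => P a x].
under eq_bigr => x _ do under eq_bigr => a _ do
  rewrite /dffun_of_fprod ffunE -[P a _](ffunE (P a)) -/(p a).
rewrite (big_fprod _ _ (fun a => p a)).
rewrite -(bigA_distr_big_dep (tagged_with T) (fun a u => untag 0 (p a) u)).
apply: big1 => a _; rewrite -(big_tag (fun a => p a) a) -(dist_sum1 (P a)).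
by apply: eq_bigr => x _; rewrite ffunE.
Qed.

Definition dprod : dist R {dffun forall a, T a} := Dist dprod_ge0 dprod_sum1.
End IndexedProduct.

Section Mixture.
Variables (A : finType) (PA : dist R A).
Variables (T : A -> finType) (P : forall a, dist R (T a)).

Lemma dmix_ge0 (x : {a : A & T a}) : 0 <= PA (tag x) * P (tag x) (tagged x).
Proof. by apply: mulr_ge0; exact: dist_ge0. Qed.

Lemma dmix_sum1 :
  \sum_(x : {a : A & T a}) PA (tag x) * P (tag x) (tagged x) = 1.
Proof.
rewrite -(sig_big_dep xpredT (fun=> xpredT) (fun a x => PA a * P a x)) /=.
rewrite -(dist_sum1 PA).
by apply: eq_bigr => a _; rewrite -mulr_sumr dist_sum1 mulr1.
Qed.

Definition dmix : dist R {a : A & T a} := Dist dmix_ge0 dmix_sum1.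
End Mixture.

(* In bits; the convention 0 log 0 = 0 holds since the summand is 0 * ln 0. *)
Definition entropy (T : finType) (P : dist R T) : R :=
  - \sum_x P x * (ln (P x) / ln 2).

End Dist.

Record pgraph (R : realType) := PGraph {
  vertex : finType;
  adj : rel vertex;
  adj_sym : symmetric adj;
  adj_irr : irreflexive adj;
  vdist : dist R vertex }.

Section PGraph.
Variable R : realType.

Section BinaryAnd.
Variables G1 G2 : pgraph R.

Definition and2_adj : rel (vertex G1 * vertex G2) := fun v v' =>
  [&& v != v', (v.1 == v'.1) || adj v.1 v'.1 & (v.2 == v'.2) || adj v.2 v'.2].

Lemma and2_adj_sym : symmetric and2_adj.
Proof.
move=> v v'; rewrite /and2_adj eq_sym (eq_sym v.1) (eq_sym v.2).
by rewrite (adj_sym v.1) (adj_sym v.2).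
Qed.

Lemma and2_adj_irr : irreflexive and2_adj.
Proof. by move=> v; rewrite /and2_adj eqxx. Qed.

Definition pg_and2 : pgraph R :=
  PGraph and2_adj_sym and2_adj_irr (dprod2 (vdist G1) (vdist G2)).
End BinaryAnd.

(* The AND product of a finite family. It is the iterated binary product up to
   isomorphism: see [pg_and_recl], [pg_and_ord1] and [pg_and_reindex]. *)
Section IndexedAnd.
Variables (A : finType) (G : A -> pgraph R).

Definition and_adj : rel {dffun forall a, vertex (G a)} := fun v v' =>
  (v != v') && [forall a, (v a == v' a) || adj (v a) (v' a)].

Lemma and_adj_sym : symmetric and_adj.
Proof.
move=> v v'; rewrite /and_adj eq_sym; congr (_ && _).
by apply: eq_forallb => a; rewrite eq_sym adj_sym.
Qed.

Lemma and_adj_irr : irreflexive and_adj.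
Proof. by move=> v; rewrite /and_adj eqxx. Qed.

Definition pg_and : pgraph R :=
  PGraph and_adj_sym and_adj_irr (dprod (fun a => vdist (G a))).
End IndexedAnd.

Definition pg_pow (G : pgraph R) (n : nat) : pgraph R :=
  pg_and (fun _ : 'I_n => G).

Section DisjointUnion.
Variables (A : finType) (PA : dist R A) (G : A -> pgraph R).

(* [tagged_as u w] is the second component of [w], cast to the type of that of
   [u]; the first conjunct makes this cast meaningful. *)
Definition union_adj : rel {a : A & vertex (G a)} := fun u w =>
  (tag u == tag w) && adj (tagged u) (tagged_as u w).

Lemma union_adj_sym : symmetric union_adj.
Proof.
move=> [a v] [b w]; rewrite /union_adj /= eq_sym.
have [eq_ba|//] := eqVneq b a; case: _ / eq_ba v => /= v in w *.
by rewrite !tagged_asE adj_sym.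
Qed.

Lemma union_adj_irr : irreflexive union_adj.
Proof. by case=> a v; rewrite /union_adj tagged_asE adj_irr andbF. Qed.

Definition pg_union : pgraph R :=
  PGraph union_adj_sym union_adj_irr (dmix PA (fun a => vdist (G a))).
End DisjointUnion.

Definition coloring (G : pgraph R) (C : Type) (c : vertex G -> C) : Prop :=
  forall v w, adj v w -> c v <> c w.

Definition chromatic_entropy (G : pgraph R) : R :=
  inf [set h | exists (C : finType) (c : vertex G -> C),
         coloring c /\ h = entropy (dmap (vdist G) c)].

(* The limit exists by subadditivity of [n |-> chromatic_entropy (pg_pow G n)],
   so [limn] never takes its default value here. *)
Definition complementary_graph_entropy (G : pgraph R) : R :=
  limn (fun n => chromatic_entropy (pg_pow G n) / n%:R).

Definition pg_iso (G H : pgraph R) : Prop :=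
  exists2 f : vertex G -> vertex H, bijective f &
    {mono f : v w / adj v w} /\ (forall v, vdist H (f v) = vdist G v).

Lemma pg_and_recl n (G : 'I_n.+1 -> pgraph R) :
  pg_iso (pg_and G)
    (pg_and2 (G ord0) (pg_and (fun i => G (lift ord0 i)))).
Proof.
pose f (v : vertex (pg_and G)) :
    vertex (pg_and2 (G ord0) (pg_and (fun i => G (lift ord0 i)))) :=
  (v ord0, [ffun i : 'I_n => v (lift ord0 i)]).
have f_inj : injective f.
  move=> v w [vw0 /ffunP vwS]; apply/ffunP => i.
  by case: (unliftP ord0 i) => [j ->|-> //]; have := vwS j; rewrite !ffunE.
exists f.
  apply: (inj_card_bij f_inj); rewrite card_prod !card_dep_ffun !foldrE.
  by rewrite !big_image /= big_ord_recl.
split=> [v w|v] /=.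
  rewrite /and2_adj /and_adj (inj_eq f_inj); case: eqVneq => //= vw.
  have -> (x y : bool) : x || ~~ x && y = x || y by case: x.
  apply/andP/forallP => [[vw0 vwS] i|vwA].
    case: (unliftP ord0 i) => [j ->|-> //]; case/orP: vwS => [/eqP/ffunP|].
      by move=> /(_ j); rewrite !ffunE => ->; rewrite eqxx.
    by move=> /forallP/(_ j); rewrite !ffunE.
  split; [exact: vwA | apply/orP; right].
  by apply/forallP => j; rewrite !ffunE; exact: vwA.
by rewrite big_ord_recl; congr (_ * _); apply: eq_bigr => i _; rewrite ffunE.
Qed.

Lemma pg_and_ord1 (G : 'I_1 -> pgraph R) : pg_iso (pg_and G) (G ord0).
Proof.
pose f (v : vertex (pg_and G)) := v ord0.
have f_inj : injective f.
  by move=> v w vw; apply/ffunP => i; rewrite (ord1 i).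
exists f.
  apply: (inj_card_bij f_inj); rewrite card_dep_ffun foldrE.
  by rewrite big_image /= big_ord_recl big_ord0 muln1.
split=> [v w|v] /=; last by rewrite big_ord_recl big_ord0 mulr1.
rewrite /and_adj -(inj_eq f_inj) /f; apply/idP/idP => [vw|/andP[vw]].
  rewrite (contraTneq _ vw) => [|->]; last by rewrite adj_irr.
  by apply/forallP => i; rewrite (ord1 i) vw orbT.
by move=> /forallP/(_ ord0); rewrite (negbTE vw).
Qed.

Lemma pg_and_reindex (A B : finType) (f : A -> B) (G : B -> pgraph R) :
  bijective f -> pg_iso (pg_and G) (pg_and (fun a => G (f a))).
Proof.
move=> f_bij; have [g fK gK] := f_bij.
pose h (v : vertex (pg_and G)) : vertex (pg_and (fun a => G (f a))) :=
  [ffun a : A => v (f a)].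
have h_inj : injective h.
  move=> v w /ffunP vw; apply/ffunP => b; rewrite -(gK b).
  by have := vw (g b); rewrite !ffunE.
exists h.
  apply: (inj_card_bij h_inj); rewrite !card_dep_ffun !foldrE !big_image /=.
  by rewrite (reindex f) //; exact: onW_bij.
split=> [v w|v] /=.
  rewrite /and_adj (inj_eq h_inj); congr (_ && _).
  apply/forallP/forallP => [vw b|vw a]; last by rewrite !ffunE.
  by rewrite -(gK b); have := vw (g b); rewrite !ffunE.
rewrite [RHS](reindex f) /=; last exact: onW_bij.
by apply: eq_bigr => a _; rewrite ffunE.
Qed.

End PGraph.

(* Main.v *)
(** Write [k = #|A|], [U] for the uniform union and [W] for the AND product of the
    [G a]. There are no edges of [U^n] between different words [a] of [A^n], so
    [U^n] is the union over [a] of the products [G (a 0) /\ ... /\ G (a (n-1))], and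
    such a product depends, up to isomorphism, only on the number of occurrences
    of each letter in [a]. Hence the chromatic entropy of [U^n] is the mean of
    those of the products, up to the entropy of the type of [a], which is at most
    [k log (n + 1)].
    Chromatic entropy is monotone and subadditive for AND products, so that of
    the product over [a] is Lipschitz in the occurrence counts. For [n = k m]
    these have mean [m] and variance at most [n], and the word in which every
    letter occurs [m] times gives [W^m]. So the chromatic entropies of [U^(k m)]
    and [W^m] differ by [O(sqrt m + log m)]; as both limits exist by Fekete's
    lemma, they can be compared along [m = l ^ 2]. *)

Require Import Defs.
From mathcomp Require Import all_boot all_order all_algebra.
From mathcomp Require Import all_classical all_reals all_analysis.
From mathcomp Require Import ring lra.

Set Implicit Arguments.
Unset Strict Implicit.
Unset Printing Implicit Defensive.

Import Order.TTheory GRing.Theory Num.Theory.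
Import numFieldNormedType.Exports.
Local Open Scope ring_scope.
Local Open Scope classical_set_scope.

Lemma big_sigT (R : Type) (idx : R) (op : Monoid.com_law idx) (X : finType)
    (T : X -> finType) (P : pred {x : X & T x}) (F : {x : X & T x} -> R) :
  \big[op/idx]_(u | P u) F u =
  \big[op/idx]_x \big[op/idx]_(v : T x | P (Tagged T v)) F (Tagged T v).
Proof.
rewrite (sig_big_dep xpredT (fun x (v : T x) => P (Tagged T v))
  (fun x (v : T x) => F (Tagged T v))).
by apply: eq_big => [[x v]|[x v]].
Qed.

(** * Shannon entropy: Gibbs' inequality, concavity and the chain rule *)

Section Entropy.
Variable R : realType.

Lemma ln2_gt0 : 0 < ln 2 :> R.
Proof. by rewrite ln_gt0 // ltr1n. Qed.

(** The tangent bound [ln t <= t - 1] at [t = q / p]. Summed over two distributions, the terms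
    [q - p] cancel, which is Gibbs' inequality. Absolute continuity excludes [q = 0 < p], where the
    default [ln 0 = 0] would break the bound. *)
Lemma gibbs_term (p q : R) : 0 <= p -> 0 <= q -> (q = 0 -> p = 0) ->
  p * ln q <= p * ln p + (q - p).
Proof.
move=> p_ge0 q_ge0 qp0; have [p0|p_neq0] := eqVneq p 0.
  by rewrite p0 !mul0r add0r subr0.
have p_gt0 : 0 < p by rewrite lt_neqAle eq_sym p_neq0.
have q_gt0 : 0 < q.
  by rewrite lt_neqAle eq_sym q_ge0 andbT; apply: contra_neq p_neq0.
have : ln (1 + (q / p - 1)) <= q / p - 1.
  by apply: le_ln1Dx; rewrite ltrBrDl subrr divr_gt0.
rewrite addrC subrK ln_div ?posrE // lerBlDl => /(ler_wpM2l p_ge0).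
by rewrite mulrDr mulrBr mulrC mulr1 mulrCA mulfV // mulr1 (mulrC p).
Qed.

Lemma entropyE (T : finType) (P : dist R T) :
  entropy P = - (\sum_x P x * ln (P x)) / ln 2.
Proof. by rewrite mulNr mulr_suml; congr (- _); apply: eq_bigr => x _; rewrite mulrA. Qed.

Lemma eq_entropy (T : finType) (P Q : dist R T) :
  P =1 Q -> entropy P = entropy Q.
Proof. by move=> PQ; rewrite /entropy; under eq_bigr do rewrite PQ. Qed.

Lemma pmf_le1 (T : finType) (P : dist R T) x : P x <= 1.
Proof.
by rewrite -(dist_sum1 P) (bigD1 x) //= lerDl sumr_ge0 // => y _; exact: dist_ge0.
Qed.

Lemma entropy_ge0 (T : finType) (P : dist R T) : 0 <= entropy P.
Proof.
rewrite entropyE divr_ge0 ?(ltW ln2_gt0) // -sumrN sumr_ge0 // => x _.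
by rewrite -mulrN mulr_ge0 ?dist_ge0 // oppr_ge0 ln_le0 // pmf_le1.
Qed.

Lemma entropy_le_log_card (T : finType) (P : dist R T) :
  entropy P <= ln #|T|%:R / ln 2.
Proof.
rewrite entropyE ler_pM2r ?invr_gt0 ?ln2_gt0 //.
have T_gt0 : (0 < #|T|)%N.
  rewrite lt0n; apply/eqP => /card0_eq T0; have := dist_sum1 P.
  by rewrite big_pred0 // => /eqP; rewrite eq_sym oner_eq0.
have cT_gt0 : 0 < #|T|%:R :> R by rewrite ltr0n.
have : \sum_x P x * ln (unif R T_gt0 x) <=
    \sum_x (P x * ln (P x) + (unif R T_gt0 x - P x)).
  apply: ler_sum => x _; apply: gibbs_term; rewrite ?dist_ge0 //= => /eqP.
  by rewrite invr_eq0 gt_eqF.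
rewrite big_split sumrB !dist_sum1 subrr /= addr0 /= -mulr_suml dist_sum1 mul1r.
by rewrite lnV ?posrE //; lra.
Qed.

(** Concavity: Gibbs' inequality is applied to each [P x] against the mixture [M]. *)
Lemma entropy_concave (X T : finType) (Q : dist R X) (P : X -> dist R T)
    (M : dist R T) :
  (forall c, M c = \sum_x Q x * P x c) ->
  \sum_x Q x * entropy (P x) <= entropy M.
Proof.
move=> ME; under eq_bigr do rewrite entropyE mulrA.
rewrite -mulr_suml entropyE ler_pM2r ?invr_gt0 ?ln2_gt0 //.
under eq_bigr do rewrite mulrN.
rewrite sumrN lerN2.
have -> : \sum_c M c * ln (M c) = \sum_x Q x * \sum_c P x c * ln (M c).
  under [RHS]eq_bigr do rewrite mulr_sumr.
  rewrite exchange_big; apply: eq_bigr => c _.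
  by rewrite {1}ME mulr_suml; apply: eq_bigr => x _; rewrite mulrA.
(* If [Q x = 0], the support of [P x] need not lie in that of [M], so Gibbs' inequality is reserved
   for the other [x]. *)
apply: ler_sum => x _; have [->|Qx0] := eqVneq (Q x) 0; first by rewrite !mul0r.
rewrite ler_wpM2l ?dist_ge0 //.
have : \sum_c P x c * ln (M c) <= \sum_c (P x c * ln (P x c) + (M c - P x c)).
  apply: ler_sum => c _; apply: gibbs_term; rewrite ?dist_ge0 //.
  rewrite ME => /eqP; rewrite psumr_eq0 => [|y _]; last first.
    by rewrite mulr_ge0 ?dist_ge0.
  by move=> /allP/(_ x (mem_index_enum x)); rewrite /= mulf_eq0 (negbTE Qx0) => /eqP.
by rewrite big_split sumrB !dist_sum1 subrr /= addr0.
Qed.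

Lemma plnpM (p q : R) : 0 <= p -> 0 <= q ->
  p * q * ln (p * q) = q * (p * ln p) + p * (q * ln q).
Proof.
rewrite !le_eqVlt => /predU1P[<-|p_gt0] /predU1P[<-|q_gt0];
  rewrite ?mul0r ?mulr0 ?mul0r ?addr0 //.
by rewrite lnM ?posrE //; ring.
Qed.

(** Chain rule: the sampled pair determines its tag, and the law given the tag [x] is [P x]. *)
Lemma entropy_dmix (X : finType) (Q : dist R X) (T : X -> finType)
    (P : forall x, dist R (T x)) :
  entropy (dmix Q P) = entropy Q + \sum_x Q x * entropy (P x).
Proof.
under eq_bigr do rewrite entropyE mulrA.
rewrite -mulr_suml !entropyE -mulrDl; congr (_ / _).
under [X in _ = _ + X]eq_bigr do rewrite mulrN.
rewrite sumrN -opprD; congr (- _) => /=.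
rewrite big_sigT /= -big_split /=.
apply: eq_bigr => x _; under eq_bigr do rewrite plnpM ?dist_ge0 //.
by rewrite big_split /= -mulr_suml -mulr_sumr dist_sum1 mul1r.
Qed.

Lemma entropy_dprod2 (S T : finType) (P : dist R S) (Q : dist R T) :
  entropy (dprod2 P Q) = entropy P + entropy Q.
Proof.
rewrite !entropyE -mulrDl -opprD; congr (- _ / _) => /=.
rewrite -(pair_bigA _ (fun x y => P x * Q y * ln (P x * Q y))) /=.
under eq_bigr => x _ do under eq_bigr => y _ do rewrite plnpM ?dist_ge0 //.
under eq_bigr => x _ do
  rewrite big_split /= -mulr_suml -mulr_sumr dist_sum1 mul1r.
by rewrite big_split /= -mulr_suml dist_sum1 mul1r.
Qed.

End Entropy.

(** * Chromatic entropy under homomorphisms, disjoint unions and binary AND products *)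

Section ChromaticEntropy.
Variable R : realType.
Implicit Types G H : pgraph R.

Let entropies G := [set h | exists (C : finType) (c : vertex G -> C),
  coloring c /\ h = entropy (dmap (vdist G) c)].

Lemma coloring_id G : coloring (@id (vertex G)).
Proof. by move=> v w /[swap] ->; rewrite adj_irr. Qed.

Let entropies_nonempty G : entropies G !=set0.
Proof.
by exists (entropy (dmap (vdist G) id)), (vertex G), id; split=> //; exact: coloring_id.
Qed.

Let entropies_lbound G : lbound (entropies G) 0.
Proof. by move=> _ [C [c [_ ->]]]; exact: entropy_ge0. Qed.

Lemma chromatic_entropy_ge0 G : 0 <= chromatic_entropy G.
Proof. exact: lb_le_inf (entropies_nonempty G) (@entropies_lbound G). Qed.

Lemma chromatic_entropy_le G (C : finType) (c : vertex G -> C) :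
  coloring c -> chromatic_entropy G <= entropy (dmap (vdist G) c).
Proof.
move=> cP; apply: ge_inf; first by exists 0; exact: entropies_lbound.
by exists C, c.
Qed.

Lemma chromatic_entropy_ge G (x : R) :
  (forall (C : finType) (c : vertex G -> C), coloring c ->
    x <= entropy (dmap (vdist G) c)) -> x <= chromatic_entropy G.
Proof.
move=> xP; apply: lb_le_inf (entropies_nonempty G) _ => _ [C [c [cP ->]]].
exact: xP.
Qed.

Lemma chromatic_entropy_adherent G (e : R) : 0 < e ->
  exists (C : finType) (c : vertex G -> C), coloring c /\
    entropy (dmap (vdist G) c) <= chromatic_entropy G + e.
Proof.
move=> e_gt0; have [] := @inf_adherent _ (entropies G) _ e_gt0.
  by split; [exact: entropies_nonempty | exists 0; exact: entropies_lbound].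
by move=> _ [C [c [cP ->]]] /ltW le_e; exists C, c.
Qed.

Lemma chromatic_entropy_le_log_card G :
  chromatic_entropy G <= ln #|vertex G|%:R / ln 2.
Proof.
apply: le_trans (chromatic_entropy_le (@coloring_id G)) _.
exact: entropy_le_log_card.
Qed.

(** A measure-preserving graph homomorphism. It may merge vertices, which is what allows several
    components of a union to be glued onto one graph. *)
Definition pg_hom G H (f : vertex G -> vertex H) :=
  {homo f : v w / adj v w} /\ dmap (vdist G) f =1 vdist H.

(** A coloring of [H] pulls back along [f] to a coloring of [G] with the same color law. *)
Lemma chromatic_entropy_hom G H (f : vertex G -> vertex H) :
  pg_hom f -> chromatic_entropy G <= chromatic_entropy H.
Proof.
move=> [f_adj f_dist]; apply: chromatic_entropy_ge => C c cP.
have cfP : coloring (c \o f) by move=> v w /f_adj/cP.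
apply: le_trans (chromatic_entropy_le cfP) _.
rewrite le_eqVlt (_ : entropy _ = entropy (dmap (vdist H) c)) ?eqxx //.
apply: eq_entropy => y /=; rewrite (partition_big f (fun u => c u == y)) //=.
apply: eq_bigr => u /eqP cu; rewrite -f_dist /=; apply: eq_bigl => v.
by case: (f v =P u) => [->|]; rewrite ?cu ?eqxx ?andbF.
Qed.

Lemma pg_hom_bij G H (f : vertex G -> vertex H) : bijective f ->
  {homo f : v w / adj v w} -> (forall v, vdist H (f v) = vdist G v) -> pg_hom f.
Proof.
move=> [g fK gK] f_adj f_dist; split=> // u /=.
rewrite (big_pred1 (g u)) => [|v]; first by rewrite -f_dist gK.
by apply/eqP/eqP => [<-|->]; rewrite ?fK ?gK.
Qed.

Lemma pg_iso_hom G H : pg_iso G H -> exists f : vertex G -> vertex H, pg_hom f.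
Proof.
move=> [f f_bij [f_adj f_dist]]; exists f; apply: pg_hom_bij => // v w.
by rewrite f_adj.
Qed.

Lemma pg_iso_sym G H : pg_iso G H -> pg_iso H G.
Proof.
move=> [f [g fK gK] [f_adj f_dist]]; exists g; first by exists f.
by split=> [v w|v]; rewrite -?f_adj -?f_dist !gK.
Qed.

Lemma chromatic_entropy_iso G H :
  pg_iso G H -> chromatic_entropy G = chromatic_entropy H.
Proof.
move=> GH; apply/le_anti.
have [f f_hom] := pg_iso_hom GH; have [g g_hom] := pg_iso_hom (pg_iso_sym GH).
by rewrite (chromatic_entropy_hom f_hom) (chromatic_entropy_hom g_hom).
Qed.

Section Union.
Variables (X : finType) (Q : dist R X) (F : X -> pgraph R).

Lemma union_adj_same x (v w : vertex (F x)) :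
  @adj _ (pg_union Q F) (Tagged (fun x => vertex (F x)) v)
    (Tagged (fun x => vertex (F x)) w) = adj v w.
Proof. by rewrite /= /union_adj /= eqxx tagged_asE. Qed.

(** A coloring of the union restricts to each component, and its color law is the mixture of the
    restricted laws; entropy is concave. *)
Lemma chromatic_entropy_union_ge :
  \sum_x Q x * chromatic_entropy (F x) <= chromatic_entropy (pg_union Q F).
Proof.
apply: chromatic_entropy_ge => C c cP.
pose cx x (v : vertex (F x)) := c (Tagged (fun x => vertex (F x)) v).
apply: (@le_trans _ _ (\sum_x Q x * entropy (dmap (vdist (F x)) (@cx x)))).
  apply: ler_sum => x _; rewrite ler_wpM2l ?dist_ge0 //.
  by apply: chromatic_entropy_le => v w vw; apply: cP; rewrite union_adj_same.
apply: entropy_concave => y /=.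
rewrite big_sigT /=.
by apply: eq_bigr => x _; rewrite mulr_sumr.
Qed.

(** Each component gets a nearly optimal coloring with its own palette. The color then reveals the
    component, and the chain rule gives the entropy. *)
Lemma chromatic_entropy_union_le :
  chromatic_entropy (pg_union Q F) <=
  entropy Q + \sum_x Q x * chromatic_entropy (F x).
Proof.
apply/ler_addgt0Pr => e e_gt0.
pose C_ x := cid (chromatic_entropy_adherent (F x) e_gt0).
pose C x := sval (C_ x); pose c_ x := cid (svalP (C_ x)).
pose c x : vertex (F x) -> C x := sval (c_ x).
have cP x : coloring (c x) /\
  entropy (dmap (vdist (F x)) (c x)) <= chromatic_entropy (F x) + e := svalP (c_ x).
pose d (u : vertex (pg_union Q F)) : {x : X & C x} :=
  Tagged (fun x => C x) (c (tag u) (tagged u)).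
have dP : coloring d.
  move=> [x v] [y w]; rewrite /= /union_adj /= => /andP[/eqP xy].
  case: _ / xy w => w; rewrite tagged_asE => vw /eqP.
  rewrite /d /= eq_Tagged /= => /eqP.
  by have [/(_ _ _ vw)] := cP x.
apply: le_trans (chromatic_entropy_le dP) _.
rewrite (@eq_entropy _ _ _ (dmix Q (fun x => dmap (vdist (F x)) (c x)))).
  rewrite entropy_dmix -addrA lerD2l -[e]mul1r -(dist_sum1 Q) mulr_suml -big_split /=.
  apply: ler_sum => x _; rewrite -mulrDr ler_wpM2l ?dist_ge0 //.
  by have [_] := cP x.
move=> [y b] /=.
rewrite big_sigT /=.
rewrite (bigD1 y) //= [X in _ + X]big1 ?addr0 => [|x xy].
  by rewrite mulr_sumr; apply: eq_bigl => v; rewrite /d eq_Tagged.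
by rewrite big_pred0 // => v; apply: contra_neqF xy => /eqP/(congr1 tag).
Qed.

End Union.

(** Components with the same label under [t] are superposed on one copy of [K], whose weight is
    their total weight. *)
Lemma pg_hom_union (X T : finType) (Q : dist R X) (t : X -> T)
    (F : X -> pgraph R) (K : T -> pgraph R)
    (f : forall x, vertex (F x) -> vertex (K (t x))) :
  (forall x, pg_hom (f x)) ->
  @pg_hom (pg_union Q F) (pg_union (dmap Q t) K)
    (fun u => Tagged (fun x => vertex (K x)) (f (tag u) (tagged u))).
Proof.
move=> f_hom; split=> [[x v] [y w]|[s k]].
  rewrite /= /union_adj /= => /andP[/eqP xy].
  case: _ / xy w => w; rewrite !tagged_asE eqxx /= => vw.
  by have [f_adj _] := f_hom x; exact: f_adj.
rewrite /= big_sigT /=.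
rewrite (bigID (fun x => t x == s)) /= [X in _ + X]big1 ?addr0 => [|x xs]; last first.
  by rewrite big_pred0 // => v; apply: contraNF xs => /eqP/(congr1 tag)/= ->.
rewrite mulr_suml; apply: eq_bigr => x /eqP xs; case: _ / xs k => k.
rewrite -mulr_sumr; congr (_ * _); have [_ <-] := f_hom x.
by apply: eq_bigl => v; rewrite eq_Tagged.
Qed.

(** Pairs of colors color the product: equal pairs exclude an edge in either coordinate, so adjacent
    vertices would coincide. *)
Lemma chromatic_entropy_and2_le G H :
  chromatic_entropy (pg_and2 G H) <= chromatic_entropy G + chromatic_entropy H.
Proof.
apply/ler_addgt0Pr => e e_gt0; have e2_gt0 : 0 < e / 2 by rewrite divr_gt0.
have [C [c [cP c_le]]] := chromatic_entropy_adherent G e2_gt0.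
have [D [d [dP d_le]]] := chromatic_entropy_adherent H e2_gt0.
pose b (u : vertex (pg_and2 G H)) := (c u.1, d u.2).
have bP : coloring b.
  move=> [v v'] [w w'] /and3P[/= neq + +] [cvw dvw].
  case/predU1P=> [eq_vw|/cP/(_ cvw)//]; case/predU1P=> [eq_vw'|/dP/(_ dvw)//].
  by rewrite eq_vw eq_vw' eqxx in neq.
apply: le_trans (chromatic_entropy_le bP) _.
rewrite (@eq_entropy _ _ _ (dprod2 (dmap (vdist G) c) (dmap (vdist H) d))).
  by rewrite entropy_dprod2; lra.
move=> [x y] /=; rewrite mulr_suml.
under [RHS]eq_bigr do rewrite mulr_sumr.
rewrite (pair_big_dep _ _ (fun v w => vdist G v * vdist H w)) /=.
by apply: eq_bigl.
Qed.

(** The product contains a copy of [G] above every vertex of [H]. The union of these copies,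
    weighted by [vdist H], maps bijectively to it and preserves edges. *)
Lemma chromatic_entropy_and2_ge G H :
  chromatic_entropy G <= chromatic_entropy (pg_and2 G H).
Proof.
pose U := pg_union (vdist H) (fun=> G).
pose f (u : vertex U) : vertex (pg_and2 G H) := (tagged u, tag u).
have f_hom : pg_hom f.
  apply: pg_hom_bij => [|[x v] [y w]|[x v] /=]; last by rewrite mulrC.
    by exists (fun u => @Tagged _ u.2 (fun=> vertex G) u.1 : vertex U) => [[]|[]].
  rewrite /= /union_adj /= => /andP[/eqP xy].
  case: _ / xy w => w; rewrite tagged_asE => vw.
  rewrite /and2_adj /f /= -pair_eqE /= !eqxx andbT vw orbT !andbT.
  by apply: contraTneq vw => ->; rewrite adj_irr.
apply: le_trans (chromatic_entropy_hom f_hom).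
apply: le_trans (chromatic_entropy_union_ge _ _).
by rewrite -mulr_suml dist_sum1 mul1r.
Qed.

End ChromaticEntropy.

(** * Occurrence counts of words *)

(* The occurrence counts of [a] are the (unnormalised) type of the word [a]. *)
Definition occ (I A : finType) (a : I -> A) (x : A) : nat := #|[pred i | a i == x]|.

Lemma sum_occ (I A : finType) (a : I -> A) : (\sum_x occ a x)%N = #|I|.
Proof.
rewrite -sum1_card (partition_big a xpredT) //=; apply: eq_bigr => x _.
by rewrite /occ -sum1_card; apply: eq_bigl => i; rewrite !inE.
Qed.

Lemma occ_sum (I J A : finType) (a : I + J -> A) x :
  occ a x = (occ (a \o inl) x + occ (a \o inr) x)%N.
Proof. by rewrite /occ -!sum1_card big_sumType. Qed.

Lemma occ_tag (A : finType) (N : A -> nat) (x : A) :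
  occ (fun p : {x : A & 'I_(N x)} => tag p) x = N x.
Proof.
rewrite /occ -sum1_card big_sigT /= (bigD1 x) //= [X in (_ + X)%N]big1 => [|y yx].
  rewrite /= addn0 (eq_bigl (fun i => i \in 'I_(N x))) => [|i].
    by rewrite sum1_card card_ord.
  by rewrite !inE /= eqxx.
by rewrite big_pred0 // => i; rewrite !inE /= (negbTE yx).
Qed.

Lemma card_tag_ord (A : finType) (N : A -> nat) :
  #|{: {x : A & 'I_(N x)}}| = (\sum_x N x)%N.
Proof.
by rewrite -(sum_occ (fun p : {x : A & 'I_(N x)} => tag p)); apply: eq_bigr => x _; rewrite occ_tag.
Qed.

Lemma occ_fst (A J : finType) (x : A) : occ (@fst A J) x = #|J|.
Proof.
rewrite /occ -sum1_card (eq_bigl (fun p : A * J => (p.1 == x) && true)) => [|p].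
  rewrite -(pair_big (pred1 x) xpredT (fun _ _ => 1%N)) /= big_pred1_eq.
  by rewrite sum1_card.
by rewrite !inE andbT.
Qed.

(** The bijection sends the r-th occurrence of each letter in [a] to its r-th occurrence in [b]. *)
Lemma occ_eq_bij (I J A : finType) (a : I -> A) (b : J -> A) :
  occ a =1 occ b -> exists2 f : I -> J, bijective f & b \o f = a.
Proof.
move=> ab; pose s x := enum [pred i | a i == x]; pose t x := enum [pred j | b j == x].
have exf i : exists j, b j = a i /\ index j (t (a i)) = index i (s (a i)).
  have : (index i (s (a i)) < size (t (a i)))%N.
    by rewrite -cardE -[X in (_ < X)%N]ab /occ cardE index_mem mem_enum inE.
  case t_ai: (t (a i)) => [//|j0 r]; rewrite -t_ai => lt_i.
  exists (nth j0 (t (a i)) (index i (s (a i)))).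
  rewrite index_uniq ?enum_uniq //; split=> //; apply/eqP.
  by have := mem_nth j0 lt_i; rewrite mem_enum.
have [f fP] := choice exf.
have f_inj : injective f.
  move=> i i' ff; have [bi ri] := fP i; have [bi' ri'] := fP i'.
  have aa : a i = a i' by rewrite -bi -bi' ff.
  have si : i \in s (a i) by rewrite mem_enum inE.
  have si' : i' \in s (a i) by rewrite mem_enum inE aa.
  have rr : index i (s (a i)) = index i' (s (a i)) by rewrite -ri ff aa ri'.
  by rewrite -(nth_index i si) -[RHS](nth_index i si') rr.
exists f; last by apply: funext => i; have [] := fP i.
apply: inj_card_bij f_inj _; rewrite -(sum_occ a) -(sum_occ b).
by apply: leq_sum => x _; rewrite ab.
Qed.

(** * AND products indexed by words *)

Section AndProducts.
Variable R : realType.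

Lemma pg_and_iso_occ (I J A : finType) (G : A -> pgraph R) (a : I -> A) (b : J -> A) :
  occ a =1 occ b ->
  pg_iso (pg_and (fun i => G (a i))) (pg_and (fun j => G (b j))).
Proof.
move=> ab; have [f f_bij bf] := occ_eq_bij ab.
rewrite (_ : (fun i => G (a i)) = (fun i => G (b (f i)))); last by rewrite -bf.
exact/pg_iso_sym/pg_and_reindex.
Qed.

Lemma pg_and_sum (I J : finType) (F : I + J -> pgraph R) :
  pg_iso (pg_and F)
    (pg_and2 (pg_and (fun i => F (inl i))) (pg_and (fun j => F (inr j)))).
Proof.
pose f (v : vertex (pg_and F)) :
    vertex (pg_and2 (pg_and (fun i => F (inl i))) (pg_and (fun j => F (inr j)))) :=
  ([ffun i : I => v (inl i)], [ffun j : J => v (inr j)]).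
have f_inj : injective f.
  move=> v w [/ffunP vwl /ffunP vwr]; apply/ffunP => -[i|j].
    by have := vwl i; rewrite !ffunE.
  by have := vwr j; rewrite !ffunE.
exists f.
  apply: (inj_card_bij f_inj); rewrite card_prod !card_dep_ffun !foldrE.
  by rewrite !big_image /= big_sumType.
split=> [v w|v] /=; last first.
  by rewrite big_sumType /=; congr (_ * _); apply: eq_bigr => i _; rewrite ffunE.
rewrite /and2_adj /and_adj (inj_eq f_inj); case: eqVneq => //= vw.
have -> (x y : bool) : x || ~~ x && y = x || y by case: x.
have -> (x y : bool) : x || ~~ x && y = x || y by case: x.
apply/andP/forallP => [[vwl vwr] [i|j]|vwA].
- case/orP: vwl => [/eqP/ffunP/(_ i)|/forallP/(_ i)]; rewrite !ffunE // => ->.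
  by rewrite eqxx.
- case/orP: vwr => [/eqP/ffunP/(_ j)|/forallP/(_ j)]; rewrite !ffunE // => ->.
  by rewrite eqxx.
by split; apply/orP; right; apply/forallP => i; rewrite !ffunE; exact: vwA.
Qed.

(** Uncurrying presents the power as the product over a word in which every letter occurs [n] times,
    the form in which it is compared with other words. *)
Lemma pg_pow_and (A : finType) (G : A -> pgraph R) n :
  pg_iso (pg_pow (pg_and G) n) (pg_and (fun p : A * 'I_n => G p.1)).
Proof.
pose f (v : vertex (pg_pow (pg_and G) n)) :
    vertex (pg_and (fun p : A * 'I_n => G p.1)) := [ffun p => v p.2 p.1].
have f_inj : injective f.
  move=> v w /ffunP vw; apply/ffunP => i; apply/ffunP => a.
  by have := vw (a, i); rewrite !ffunE.
exists f.
  apply: (inj_card_bij f_inj); rewrite !card_dep_ffun !foldrE !big_image /=.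
  rewrite -(pair_bigA _ (fun a (_ : 'I_n) => #|vertex (G a)|)) /= exchange_big /=.
  by apply: leq_prod => i _.
split=> [v w|v] /=; last first.
  under eq_bigr do rewrite ffunE /=.
  by rewrite -(pair_bigA _ (fun a i => vdist (G a) (v i a))) /= exchange_big.
rewrite /and_adj (inj_eq f_inj); congr (_ && _).
apply/forallP/forallP => [vw i|vw [a i]]; last first.
  rewrite !ffunE /=; case/orP: (vw i) => [/eqP->|/andP[_ /forallP/(_ a)//]].
  by rewrite eqxx.
have [//|vwi] := eqVneq (v i) (w i).
by apply/andP; split=> //; apply/forallP => a; have := vw (a, i); rewrite !ffunE.
Qed.

Lemma chromatic_entropy_and_sum_le (I J : finType) (F : I + J -> pgraph R) :
  chromatic_entropy (pg_and F) <= chromatic_entropy (pg_and (fun i => F (inl i))) +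
    chromatic_entropy (pg_and (fun j => F (inr j))).
Proof.
rewrite (chromatic_entropy_iso (pg_and_sum F)); exact: chromatic_entropy_and2_le.
Qed.

Lemma chromatic_entropy_and_sum_ge (I J : finType) (F : I + J -> pgraph R) :
  chromatic_entropy (pg_and (fun i => F (inl i))) <= chromatic_entropy (pg_and F).
Proof.
rewrite (chromatic_entropy_iso (pg_and_sum F)); exact: chromatic_entropy_and2_ge.
Qed.

Lemma vertex_gt0 (G : pgraph R) : (0 < #|vertex G|)%N.
Proof.
rewrite lt0n; apply/eqP => /card0_eq T0; have := dist_sum1 (vdist G).
by rewrite big_pred0 // => /eqP; rewrite eq_sym oner_eq0.
Qed.

Lemma chromatic_entropy_and_le (I : finType) (F : I -> pgraph R) (m : nat) :
  (forall i, #|vertex (F i)| <= m)%N ->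
  chromatic_entropy (pg_and F) <= #|I|%:R * (ln m%:R / ln 2).
Proof.
move=> Fm; apply: le_trans (chromatic_entropy_le_log_card _) _.
rewrite mulrA ler_pM2r ?invr_gt0 ?ln2_gt0 // mulr_natl.
(* The empty product has one vertex, while [m] may then be [0]. *)
have [I0|I_gt0] := posnP #|I|.
  rewrite card_dep_ffun foldrE big_image big_pred0 ?ln1 ?I0 // => i.
  by have := card0_eq I0 i.
have m_gt0 : (0 < m)%N.
  by have /card_gt0P[i _] := I_gt0; apply: leq_trans (Fm i); exact: vertex_gt0.
rewrite -lnXn ?ltr0n // -natrX ler_ln ?posrE ?ltr0n ?expn_gt0 ?m_gt0 //; last first.
  exact: (vertex_gt0 (pg_and F)).
rewrite ler_nat card_dep_ffun foldrE big_image /= -prod_nat_const.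
exact: leq_prod.
Qed.

(* Both sides are compared with the product in which each [G x] occurs
   [maxn (occ a x) (occ b x)] times. *)
Lemma chromatic_entropy_and_occ (I J A : finType) (G : A -> pgraph R)
    (a : I -> A) (b : J -> A) (m : nat) :
  (forall x, #|vertex (G x)| <= m)%N ->
  chromatic_entropy (pg_and (fun i => G (a i))) <=
  chromatic_entropy (pg_and (fun j => G (b j))) +
    (\sum_x (occ a x - occ b x))%N%:R * (ln m%:R / ln 2).
Proof.
move=> Gm.
pose a' (p : I + {x : A & 'I_(occ b x - occ a x)}) :=
  match p with inl i => a i | inr q => tag q end.
pose b' (p : J + {x : A & 'I_(occ a x - occ b x)}) :=
  match p with inl j => b j | inr q => tag q end.
apply: le_trans (chromatic_entropy_and_sum_ge (fun p => G (a' p))) _.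
(* With truncated subtraction, [p + (q - p)] is [maxn p q], which is symmetric. *)
have ab : occ a' =1 occ b'.
  move=> x; rewrite !occ_sum.
  rewrite (occ_tag (fun x => occ b x - occ a x)%N x : occ (a' \o inr) x = _).
  rewrite (occ_tag (fun x => occ a x - occ b x)%N x : occ (b' \o inr) x = _).
  by rewrite -!maxnE maxnC.
rewrite (chromatic_entropy_iso (pg_and_iso_occ G ab)).
apply: le_trans (chromatic_entropy_and_sum_le (fun p => G (b' p))) _.
rewrite lerD2l -card_tag_ord.
exact: (@chromatic_entropy_and_le _ (fun q => G (tag q))).
Qed.

Lemma chromatic_entropy_pow_add (G : pgraph R) m n :
  chromatic_entropy (pg_pow G (m + n)) <=
  chromatic_entropy (pg_pow G m) + chromatic_entropy (pg_pow G n).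
Proof.
apply: le_trans (chromatic_entropy_and_sum_le (fun _ : 'I_m + 'I_n => G)).
have iso := pg_and_reindex (fun _ : 'I_(m + n) => G)
  (Bijective (@unsplitK m n) (@splitK m n)).
by rewrite (chromatic_entropy_iso iso).
Qed.

End AndProducts.

(** * Second moment of a sum of independent centred variables *)

Section SecondMoment.
Variables (R : realType) (A : finType) (P : dist R A).

Lemma dprod_expect_mul (n : nat) (Y : A -> R) (i j : 'I_n) :
  \sum_x P x * Y x = 0 ->
  \sum_(a : {dffun forall _ : 'I_n, A}) dprod (fun=> P) a * (Y (a i) * Y (a j)) =
  (i == j)%:R * \sum_x P x * Y x ^+ 2.
Proof.
(* [F i'] writes [Y (a i')] as a product over all coordinates with factors [1] away from [i'], so
   the sum over words factorises. For [i != j] the factor at [i] is the mean of [Y], which is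
   [0]. *)
move=> Y0; pose F i' l x := if l == i' :> 'I_n then Y x else 1.
transitivity (\prod_l \sum_x P x * (F i l x * F j l x)).
  rewrite bigA_distr_bigA; apply: eq_bigr => a _; rewrite !big_split /=.
  by congr (_ * (_ * _)); rewrite -big_mkcond big_pred1_eq.
rewrite (bigD1 i) //= {1 2}/F eqxx.
have [<-|ij] := eqVneq i j; last by under eq_bigr do rewrite mulr1; rewrite Y0 !mul0r.
rewrite mul1r [X in _ * X]big1 ?mulr1 => [|l li].
  by apply: eq_bigr => x _; rewrite expr2.
by under eq_bigr do rewrite /F (negbTE li) !mulr1; rewrite dist_sum1.
Qed.

Lemma dprod_second_moment (n : nat) (Y : A -> R) :
  \sum_x P x * Y x = 0 ->
  \sum_(a : {dffun forall _ : 'I_n, A}) dprod (fun=> P) a * (\sum_i Y (a i)) ^+ 2 =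
  n%:R * \sum_x P x * Y x ^+ 2.
Proof.
move=> Y0; under eq_bigr => a _ do (rewrite expr2 mulr_suml mulr_sumr;
  under eq_bigr => i _ do rewrite !mulr_sumr).
rewrite exchange_big; under eq_bigr => i _ do (rewrite exchange_big /=;
  under eq_bigr => j _ do rewrite dprod_expect_mul //).
rewrite (eq_bigr (fun=> \sum_x P x * Y x ^+ 2)) => [|i _].
  by rewrite sumr_const card_ord mulr_natl.
rewrite (bigD1 i) //= eqxx mul1r [X in _ + X]big1 ?addr0 // => j ji.
by rewrite eq_sym (negbTE ji) mul0r.
Qed.

End SecondMoment.

(** * Powers of a disjoint union *)

Section PowerOfUnion.
Variables (R : realType) (A : finType) (P : dist R A) (G : A -> pgraph R).

Lemma pg_pow_union n :
  pg_iso (pg_union (dprod (fun _ : 'I_n => P)) (fun a => pg_and (fun i => G (a i))))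
    (pg_pow (pg_union P G) n).
Proof.
pose U := pg_union (dprod (fun _ : 'I_n => P)) (fun a => pg_and (fun i => G (a i))).
pose V x := vertex (G x).
pose f (u : vertex U) : vertex (pg_pow (pg_union P G) n) :=
  [ffun i => Tagged V (tagged u i)].
have f_inj : injective f.
  move=> [a v] [b w] /ffunP vw.
  have ab : a = b.
    by apply/ffunP => i; have := congr1 tag (vw i); rewrite !ffunE.
  case: _ / ab w vw => w vw; congr Tagged; apply/ffunP => i; apply/eqP.
  by have /eqP := vw i; rewrite !ffunE eq_Tagged.
exists f.
  (* The word is read off the tags of [y]; [etagged] casts each component to the type given by its
     letter. *)
  have f_surj y : exists u, f u = y.
    pose a : {dffun forall _ : 'I_n, A} := [ffun i => tag (y i)].
    have aE i : tag (y i) = a i by rewrite ffunE.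
    pose v : vertex (pg_and (fun i => G (a i))) := [ffun i => etagged (aE i)].
    exists (existT (fun b : {dffun forall _ : 'I_n, A} =>
      vertex (pg_and (fun i => G (b i))) : Type) a v).
    apply/ffunP => i; rewrite ffunE /= (_ : v i = etagged (aE i)) ?etaggedK //.
    exact: ffunE.
  have [g gK] := choice f_surj.
  by exists g => // u; apply: f_inj; rewrite gK.
split=> [[a v] [b w]|[a v]] /=; last first.
  by rewrite -big_split; apply: eq_bigr => i _; rewrite ffunE.
rewrite /and_adj (inj_eq f_inj) /union_adj /=.
have [ab|ab] := eqVneq a b; last first.
  apply/negP => /andP[_ /forallP vw]; case/eqP: ab; apply/ffunP => i.
  have := vw i; rewrite !ffunE /= /union_adj => /orP[/eqP/(congr1 tag) //|].
  by case/andP => /eqP.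
case: _ / ab w => w; rewrite eq_Tagged tagged_asE /= /and_adj; congr (_ && _).
by apply: eq_forallb => i; rewrite !ffunE eq_Tagged /= /union_adj eqxx tagged_asE.
Qed.

(** Counts are at most [n], so [inord] loses nothing, and there are at most [n.+1 ^ #|A|] types. *)
Let occ_type n (a : 'I_n -> A) : {ffun A -> 'I_n.+1} := [ffun x => inord (occ a x)].

Let occ_typeE n (a : 'I_n -> A) x : occ_type a x = occ a x :> nat.
Proof.
by rewrite ffunE inordK // ltnS; apply: leq_trans (max_card _) _; rewrite card_ord.
Qed.

(** The common representative of the products over words of type [t]. *)
Let class_pg n (t : {ffun A -> 'I_n.+1}) :=
  pg_and (fun p : {x : A & 'I_(t x)} => G (tag p)).

Lemma chromatic_entropy_pow_union_ge n :
  \sum_(a : {dffun forall _ : 'I_n, A})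
    dprod (fun=> P) a * chromatic_entropy (pg_and (fun i => G (a i))) <=
  chromatic_entropy (pg_pow (pg_union P G) n).
Proof.
rewrite -(chromatic_entropy_iso (pg_pow_union n)).
exact: (@chromatic_entropy_union_ge _ _ (dprod (fun=> P))).
Qed.

(* Within a type class all the products are isomorphic and can share a coloring,
   so only the type has to be added, at a cost logarithmic in [n]. *)
Lemma chromatic_entropy_pow_union_le n :
  chromatic_entropy (pg_pow (pg_union P G) n) <=
  ln (n.+1 ^ #|A|)%:R / ln 2 +
  \sum_(a : {dffun forall _ : 'I_n, A})
    dprod (fun=> P) a * chromatic_entropy (pg_and (fun i => G (a i))).
Proof.
rewrite -(chromatic_entropy_iso (pg_pow_union n)).
have iso (a : {dffun forall _ : 'I_n, A}) :
    pg_iso (pg_and (fun i => G (a i))) (class_pg (occ_type a)).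
  apply: (@pg_and_iso_occ _ _ _ _ _ a (fun p => tag p)) => x.
  by rewrite (occ_tag (fun x => occ_type a x : nat)) occ_typeE.
pose f a := sval (cid (pg_iso_hom (iso a))).
have f_hom a : pg_hom (f a) := svalP (cid (pg_iso_hom (iso a))).
apply: le_trans (chromatic_entropy_hom (pg_hom_union (dprod (fun=> P)) f_hom)) _.
apply: le_trans (chromatic_entropy_union_le _ _) _; apply: lerD.
  by rewrite (le_trans (entropy_le_log_card _)) // card_ffun card_ord.
rewrite le_eqVlt; apply/orP; left; apply/eqP; symmetry.
rewrite (partition_big (fun a : {dffun forall _ : 'I_n, A} => occ_type a) xpredT) //=.
apply: eq_bigr => t _; rewrite mulr_suml; apply: eq_bigr => a /eqP <-.
by rewrite (chromatic_entropy_iso (iso a)).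
Qed.

End PowerOfUnion.

(** * Fekete's lemma *)

Section Fekete.
Variables (R : realType) (u : nat -> R).
Hypotheses (u_ge0 : forall n, 0 <= u n)
  (u_add : forall m n, u (m + n)%N <= u m + u n).

Lemma subadditive_mul q N : u (q * N)%N <= q%:R * u N + u 0.
Proof.
elim: q => [|q IH]; first by rewrite mul0r add0r.
rewrite mulSn; apply: le_trans (u_add _ _) _.
by rewrite -natr1; lra.
Qed.

(** Euclidean division splits [n] into blocks of length [N] and a remainder below [N], which costs
    at most [N * u 1]. The two [u 0] cover an empty quotient or remainder. *)
Lemma subadditive_div_le n N : (0 < N)%N -> (0 < n)%N ->
  u n / n%:R <= u N / N%:R + (N%:R * u 1 + u 0 *+ 2) / n%:R.
Proof.
move=> N_gt0 n_gt0; have n_gt0' : 0 < n%:R :> R by rewrite ltr0n.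
have N_gt0' : 0 < N%:R :> R by rewrite ltr0n.
rewrite ler_pdivrMr // mulrDl divfK ?gt_eqF // {1}(divn_eq n N).
apply: le_trans (u_add _ _) _; rewrite mulr2n.
apply: (@le_trans _ _ (((n %/ N)%:R * u N + u 0) + ((n %% N)%:R * u 1 + u 0))).
  apply: lerD; first exact: subadditive_mul.
  by have := subadditive_mul (n %% N) 1; rewrite muln1.
have : (n %/ N)%:R * u N <= u N / N%:R * n%:R.
  rewrite mulrAC ler_pdivlMr // mulrAC -natrM mulrC ler_wpM2l // ler_nat.
  exact: leq_trunc_div.
have : (n %% N)%:R * u 1 <= N%:R * u 1.
  by rewrite ler_wpM2r // ler_nat ltnW // ltn_mod.
lra.
Qed.

Lemma fekete : cvgn (fun n => u n / n%:R).
Proof.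
(* The limit is the infimum over [n > 0]; at [n = 0] the quotient is [0] by convention and would
   spoil it. *)
pose S := [set x | exists2 n, (0 < n)%N & x = u n / n%:R].
have S_lb : lbound S 0 by move=> _ [n _ ->]; rewrite divr_ge0.
have S_inf : has_inf S by split; [exists (u 1 / 1%:R), 1%N | exists 0].
apply/cvg_ex; exists (inf S); apply/cvgrPdist_le => e e_gt0.
have e2_gt0 : 0 < e / 2 by rewrite divr_gt0.
have [_ [N N_gt0 ->] uN] := inf_adherent e2_gt0 S_inf.
near=> n.
have n_gt0 : (0 < n)%N by near: n; exists 1%N.
have infS_le : inf S <= u n / n%:R by apply: ge_inf; [exists 0 | exists n].
rewrite distrC ger0_norm ?subr_ge0 // lerBlDl.
apply: le_trans (subadditive_div_le N_gt0 n_gt0) _.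
have : (N%:R * u 1 + u 0 *+ 2) / n%:R <= e / 2.
  rewrite ler_pdivrMr ?ltr0n // -ler_pdivrMl //.
  by near: n; exact: nbhs_infty_ger.
lra.
Unshelve. all: by end_near. Qed.

End Fekete.

(** * Concentration of the occurrence counts of a uniform random word *)

Lemma natr_occ (R : realType) (I A : finType) (a : I -> A) (x : A) :
  (occ a x)%:R = \sum_i (a i == x)%:R :> R.
Proof.
rewrite /occ -sum1_card natr_sum big_mkcond.
by apply: eq_bigr => i _; rewrite inE; case: eqP.
Qed.

(** Since [t ^ 2 - t * s + s ^ 2 >= 0], a deviation is controlled by its square, so the variance
    bounds its mean; [s] is tuned later. *)
Lemma natr_subn_le (R : realType) (p q : nat) (s : R) : 0 < s ->
  (p - q)%:R <= (p%:R - q%:R) ^+ 2 / s + s.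
Proof.
move=> s_gt0; have [pq|/ltnW qp] := leqP p q.
  rewrite (eqP pq) addr_ge0 ?divr_ge0 ?sqr_ge0 // ltW //.
rewrite natrB // -lerBlDr ler_pdivlMr //; set t : R := p%:R - q%:R.
have := sqr_ge0 (t - s / 2); have := sqr_ge0 s; rewrite !expr2; nra.
Qed.

Section Concentration.
Variables (R : realType) (A : finType) (A_gt0 : (0 < #|A|)%N).
Variable m : nat.
Let Q := dprod (fun _ : 'I_(#|A| * m) => unif R A_gt0).

Lemma occ_variance_le (x : A) :
  \sum_(a : {dffun forall _ : 'I_(#|A| * m), A}) Q a * ((occ a x)%:R - m%:R) ^+ 2 <=
  (#|A| * m)%:R.
Proof.
have k_gt0 : 0 < #|A|%:R :> R by rewrite ltr0n.
(* The centred indicator of the letter [x]: the [#|A| * m] copies of the mean [#|A|^-1] add up to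
   [m]. *)
pose Y y : R := (y == x)%:R - #|A|%:R^-1.
have Y0 : \sum_y unif R A_gt0 y * Y y = 0.
  rewrite /= -mulr_sumr sumrB (unif_sum1 _ A_gt0) (bigD1 x) //= eqxx.
  by rewrite big1 ?addr0 ?subrr ?mulr0 // => y /negbTE->.
have sumY (a : {dffun forall _ : 'I_(#|A| * m), A}) :
    \sum_i Y (a i) = (occ a x)%:R - m%:R.
  rewrite sumrB sumr_const card_ord -[_ *+ (_ * _)]mulr_natl natrM mulrAC mulfV ?gt_eqF // mul1r.
  by rewrite natr_occ.
under eq_bigr do rewrite -sumY.
rewrite (dprod_second_moment _ Y0) -[leRHS]mulr1 ler_wpM2l //.
rewrite -(dist_sum1 (unif R A_gt0)); apply: ler_sum => y _.
rewrite -[leRHS]mulr1 ler_wpM2l ?dist_ge0 // /Y.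
have : #|A|%:R^-1 <= 1 :> R by rewrite invf_le1 // ler1n.
have : 0 < #|A|%:R^-1 :> R by rewrite invr_gt0.
by case: (y == x) => /=; nra.
Qed.

(** [b] stands for either truncated difference, [m - p] or [p - m], so that one estimate serves both
    directions. *)
Lemma occ_deviation_le (b : A -> nat -> nat) (s : R) : 0 < s ->
  (forall x p, (b x p)%:R <= (p%:R - m%:R) ^+ 2 / s + s) ->
  \sum_(a : {dffun forall _ : 'I_(#|A| * m), A})
    Q a * (\sum_x b x (occ a x))%N%:R <= #|A|%:R * ((#|A| * m)%:R / s + s).
Proof.
move=> s_gt0 bP.
have -> : #|A|%:R * ((#|A| * m)%:R / s + s) = \sum_(x : A) ((#|A| * m)%:R / s + s).
  by rewrite sumr_const mulr_natl.
under eq_bigr do rewrite natr_sum mulr_sumr.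
rewrite exchange_big; apply: ler_sum => x _.
apply: (@le_trans _ _ (\sum_(a : {dffun forall _ : 'I_(#|A| * m), A})
    Q a * (((occ a x)%:R - m%:R) ^+ 2 / s + s))).
  by apply: ler_sum => a _; rewrite ler_wpM2l ?dist_ge0.
under eq_bigr do rewrite mulrDr mulrA.
rewrite big_split -!mulr_suml dist_sum1 mul1r lerD2r ler_pM2r ?invr_gt0 //.
exact: occ_variance_le.
Qed.

End Concentration.

(** * Comparison of the uniform union with the AND product *)

Lemma cvg_complementary_graph_entropy (R : realType) (G : pgraph R) :
  chromatic_entropy (pg_pow G n) / n%:R @[n --> \oo] -->
  complementary_graph_entropy G.
Proof.
apply: (@fekete _ (fun n => chromatic_entropy (pg_pow G n))).
  by move=> n; exact: chromatic_entropy_ge0.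
exact: chromatic_entropy_pow_add.
Qed.

Section UniformUnion.
Variables (R : realType) (A : finType) (A_gt0 : (0 < #|A|)%N) (G : A -> pgraph R).
Let k := #|A|.
Let U := pg_union (unif R A_gt0) G.
Let vmax := \max_x #|vertex (G x)|.
(** The Lipschitz constant of chromatic entropy in the occurrence counts. *)
Let M : R := ln vmax%:R / ln 2.

Let M_ge0 : 0 <= M.
Proof.
rewrite divr_ge0 ?(ltW (ln2_gt0 R)) // ln_ge0 // ler1n.
have /card_gt0P[x _] := A_gt0.
by apply: leq_trans (vertex_gt0 (G x)) _; exact: leq_bigmax.
Qed.

Let vmaxP x : (#|vertex (G x)| <= vmax)%N.
Proof. exact: leq_bigmax. Qed.

Let pow_and_fst m :
  chromatic_entropy (pg_pow (pg_and G) m) =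
  chromatic_entropy (pg_and (fun p : A * 'I_m => G p.1)).
Proof. exact/chromatic_entropy_iso/pg_pow_and. Qed.

Lemma chromatic_entropy_pow_unif_union_ge m (s : R) : 0 < s ->
  chromatic_entropy (pg_pow (pg_and G) m) -
    k%:R * ((k * m)%:R / s + s) * M <= chromatic_entropy (pg_pow U (k * m)).
Proof.
move=> s_gt0; apply: le_trans (chromatic_entropy_pow_union_ge _ _ _).
set w := chromatic_entropy (pg_pow (pg_and G) m).
(* Writing the constant [w] as a mean over words reduces the bound to one word at a time. *)
have wE : w = \sum_(a : {dffun forall _ : 'I_(k * m), A}) dprod (fun=> unif R A_gt0) a * w.
  by rewrite -mulr_suml dist_sum1 mul1r.
rewrite lerBlDl [leLHS]wE.
pose b (x : A) p := (m - p)%N.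
have bP (x : A) p : (b x p)%:R <= (p%:R - m%:R) ^+ 2 / s + s.
  by rewrite -sqrrN opprB; exact: natr_subn_le.
apply: le_trans (lerD (ler_wpM2r M_ge0 (occ_deviation_le A_gt0 s_gt0 bP)) (lexx _)).
rewrite mulr_suml -big_split; apply: ler_sum => a _ /=.
rewrite -mulrA -mulrDr; apply: ler_wpM2l; first by rewrite prodr_ge0.
rewrite addrC /w pow_and_fst.
have := chromatic_entropy_and_occ (fun p : A * 'I_m => p.1) a vmaxP.
by under eq_bigr do rewrite occ_fst card_ord.
Qed.

Lemma chromatic_entropy_pow_unif_union_le m (s : R) : 0 < s ->
  chromatic_entropy (pg_pow U (k * m)) <=
  chromatic_entropy (pg_pow (pg_and G) m) +
    (ln ((k * m).+1 ^ k)%:R / ln 2 + k%:R * ((k * m)%:R / s + s) * M).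
Proof.
move=> s_gt0; apply: le_trans (chromatic_entropy_pow_union_le _ _ _) _.
set w := chromatic_entropy (pg_pow (pg_and G) m).
have wE : w = \sum_(a : {dffun forall _ : 'I_(k * m), A}) dprod (fun=> unif R A_gt0) a * w.
  by rewrite -mulr_suml dist_sum1 mul1r.
rewrite addrCA lerD2l [X in _ <= X + _]wE [leRHS]addrC.
pose b (x : A) p := (p - m)%N.
have bP (x : A) p : (b x p)%:R <= (p%:R - m%:R) ^+ 2 / s + s by exact: natr_subn_le.
apply: le_trans (lerD (ler_wpM2r M_ge0 (occ_deviation_le A_gt0 s_gt0 bP)) (lexx _)).
rewrite mulr_suml -big_split; apply: ler_sum => a _ /=.
rewrite -mulrA -mulrDr; apply: ler_wpM2l; first by rewrite prodr_ge0.
rewrite addrC /w pow_and_fst.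
have := chromatic_entropy_and_occ a (fun p : A * 'I_m => p.1) vmaxP.
by under eq_bigr do rewrite occ_fst card_ord.
Qed.

(** From [k * l.+1 ^ 2 + 1 <= (k * l.+2) ^ 2] and [ln x < x]. A linear bound is enough, because it
    is later divided by a multiple of [l.+1 ^ 2]. *)
Lemma ln_pow_types_le l :
  ln ((k * l.+1 ^ 2).+1 ^ k)%:R <= 2 * (k ^ 2)%:R * l.+2%:R :> R.
Proof.
have k_gt0 : (0 < k)%N := A_gt0.
have le_sq : ((k * l.+1 ^ 2).+1 <= (k * l.+2) ^ 2)%N.
  apply: (@leq_trans (k * l.+2 ^ 2)); first by rewrite ltn_mul2l k_gt0 ltn_exp2r /=.
  by rewrite expnMn leq_mul // leq_pmull.
rewrite natrX lnXn ?ltr0n // -[_ *+ k]mulr_natl.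
have : ln (k * l.+1 ^ 2).+1%:R <= ln ((k * l.+2)%:R ^+ 2) :> R.
  by rewrite -natrX ler_ln ?posrE ?ltr0n ?expn_gt0 ?muln_gt0 ?k_gt0 // ler_nat.
rewrite lnXn ?ltr0n ?muln_gt0 ?k_gt0 // -[_ *+ 2]mulr_natl => ln_le.
have : ln (k * l.+2)%:R <= (k * l.+2)%:R :> R.
  by rewrite ltW // ln_sublinear // ltr0n muln_gt0 k_gt0.
move/(ler_wpM2l (ler0n R 2))/(le_trans ln_le)/(ler_wpM2l (ler0n R k)).
by rewrite natrM natrX mulrCA expr2 !mulrA.
Qed.

(* Taking [m = l ^ 2] and [s = l] makes all the error terms linear in [l]. *)
Lemma chromatic_entropy_pow_unif_union_dist : exists2 C : R, 0 <= C & forall l,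
  `|chromatic_entropy (pg_pow U (k * l.+1 ^ 2)) -
    chromatic_entropy (pg_pow (pg_and G) (l.+1 ^ 2))| <= C * l.+2%:R.
Proof.
(* [C1] accounts for the entropy of the type and [C2] for the deviation: at [s = l.+1] the sum
   [k * l.+1 ^ 2 / s + s] is [(k + 1) * l.+1]. *)
pose C1 : R := 2 * (k ^ 2)%:R / ln 2.
pose C2 : R := k%:R * (k%:R + 1) * M.
have C1_ge0 : 0 <= C1 by rewrite divr_ge0 // ltW // ln2_gt0.
have C2_ge0 : 0 <= C2 by apply: mulr_ge0 M_ge0; rewrite mulr_ge0 ?addr_ge0.
exists (C1 + C2) => [|l]; first by rewrite addr_ge0.
have l_gt0 : 0 < l.+1%:R :> R by rewrite ltr0n.
have ll : l.+1%:R <= l.+2%:R :> R by rewrite ler_nat.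
have := chromatic_entropy_pow_unif_union_ge (l.+1 ^ 2) l_gt0.
have := chromatic_entropy_pow_unif_union_le (l.+1 ^ 2) l_gt0.
have -> : k%:R * ((k * l.+1 ^ 2)%:R / l.+1%:R + l.+1%:R) * M = C2 * l.+1%:R.
  by rewrite natrM natrX /C2; field; rewrite addrC natr1 gt_eqF.
have : ln ((k * l.+1 ^ 2).+1 ^ k)%:R / ln 2 <= C1 * l.+2%:R.
  by rewrite /C1 mulrAC ler_pM2r ?invr_gt0 ?ln2_gt0 // ln_pow_types_le.
have : C2 * l.+1%:R <= C2 * l.+2%:R by rewrite ler_wpM2l.
have : 0 <= C1 * l.+2%:R by rewrite mulr_ge0.
rewrite mulrDl ler_norml => *; apply/andP; split; lra.
Qed.

End UniformUnion.

Theorem mainTheorem2 (R : realType) (A : finType) (A_gt0 : (0 < #|A|)%N)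
    (G : A -> pgraph R) :
  complementary_graph_entropy (pg_union (unif R A_gt0) G) =
  #|A|%:R^-1 * complementary_graph_entropy (pg_and G).
Proof.
have [C C_ge0 CP] := chromatic_entropy_pow_unif_union_dist A_gt0 G.
set U := pg_union _ _ in CP *.
set LU := complementary_graph_entropy U; set LW := complementary_graph_entropy (pg_and G).
have k_gt0 : 0 < #|A|%:R :> R by rewrite ltr0n.
have sq_cvg : (l.+1 ^ 2)%N @[l --> \oo] --> \oo.
  apply/cvgnyPge => B; exists B => // l /= Bl.
  by apply: leq_trans Bl _; rewrite (leq_trans (leqnSn l)) // -[leqLHS]expn1 leq_pexp2l.
have ksq_cvg : (#|A| * l.+1 ^ 2)%N @[l --> \oo] --> \oo.
  exact: cvg_comp _ _ sq_cvg (cvg_mulnl _ A_gt0).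
have cvgU := cvg_comp _ _ ksq_cvg (@cvg_complementary_graph_entropy R U).
have cvgW := cvg_comp _ _ sq_cvg (@cvg_complementary_graph_entropy R (pg_and G)).
have cvgD : chromatic_entropy (pg_pow U (#|A| * l.+1 ^ 2)) / (#|A| * l.+1 ^ 2)%:R -
    #|A|%:R^-1 * (chromatic_entropy (pg_pow (pg_and G) (l.+1 ^ 2)) / (l.+1 ^ 2)%:R)
    @[l --> \oo] --> LU - #|A|%:R^-1 * LW.
  by apply: cvgB cvgU _; apply: cvgM cvgW; exact: cvg_cst.
(* [C * l.+2 / (#|A| * l.+1 ^ 2)] is at most [2 * C / #|A|] times [harmonic l = 1 / l.+1], as
   [l.+2 <= 2 * l.+1]. *)
have cvg0 : (2 * C / #|A|%:R) * harmonic l @[l --> \oo] --> (0 : R).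
  by rewrite -(mulr0 (2 * C / #|A|%:R)); apply: cvgM cvg_harmonic; exact: cvg_cst.
apply/eqP; rewrite -subr_eq0; apply/eqP.
(* The same difference of normalised entropies also tends to [0], so its limit vanishes. *)
apply: (cvg_unique _ cvgD) => //; apply: norm_cvg0.
apply: (squeeze_cvgr _ (cvg_cst 0) cvg0).
near=> l; rewrite normr_ge0 /=.
rewrite (_ : _ - _ = (chromatic_entropy (pg_pow U (#|A| * l.+1 ^ 2)) -
   chromatic_entropy (pg_pow (pg_and G) (l.+1 ^ 2))) / (#|A|%:R * l.+1%:R ^+ 2)); last first.
  by rewrite natrM natrX; field; rewrite addrC natr1 !gt_eqF.
rewrite normrM [X in _ * X]ger0_norm ?invr_ge0 ?mulr_ge0 ?exprn_ge0 //.
rewrite ler_pdivrMr ?mulr_gt0 ?exprn_gt0 ?ltr0n //.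
apply: le_trans (CP l) _.
rewrite [leRHS](_ : _ = C * (2 * l.+1%:R)); last first.
  by rewrite /harmonic /=; field; rewrite addrC natr1 !gt_eqF.
by rewrite ler_wpM2l // -natrM ler_nat mul2n -addnn addSn ltnS leq_addl.
Unshelve. all: by end_near. Qed.
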